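(* Let $X$ and $Y$ be locally compact Hausdorff spaces, and suppose $\langle B_X,\pi_X\rangle$ and $\langle B_Y,\pi_Y\rangle$ are Banach bundles over $X$ and $Y$, respectively, such that $\langle B_Y,\pi_Y\rangle$ is strictly convex. Let $T:\Gamma_X\to\Gamma_Y$ be a linear into isometry (that is, a linear isometry, not necessarily surjective). Then there exist a continuous map $\varphi$ from a nonempty subset $Y_1$ of $Y$ onto $X$, and a field of norm one linear operators $h_y:B_{\varphi(y)}\to B_y$, for all $y$ in $Y_1$, such that $$Tf(y)=h_y(f(\varphi(y))),\quad \forall\, f\in\Gamma_X,\ y\in Y_1,$$ and $$\|Tf|_{Y_1}\|=\|Tf\|,\quad\forall\, f\in\Gamma_X,$$ where $\|Tf|_{Y_1}\|=\sup\{\|Tf(y)\|:y\in Y_1\}$.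
   Context: Let $\mathbb K=\mathbb R$ or $\mathbb C$ be the underlying scalar field of all Banach spaces. Let $X$ be a locally compact Hausdorff space. Banach bundle: a Banach bundle over $X$ is a pair $\langle B_X,\pi_X\rangle$, where $B_X$ is a topological space and $\pi_X$ is a continuous open surjective map from $B_X$ onto $X$ such that, for all $x\in X$, the fiber $B_x=\pi_X^{-1}(x)$ carries a Banach space structure in the subspace topology, satisfying: (1) scalar multiplication, addition and the norm on $B_X$ are all continuous wherever they are defined; (2) if $x\in X$ and $\{b_i\}$ is any net in $B_X$ such that $\|b_i\|\to 0$ and $\pi_X(b_i)\to x$ in $X$, then $b_i\to 0_x$ (the zero element of $B_x$) in $B_X$. Continuous section space: a continuous section of $\langle B_X,\pi_X\rangle$ is a continuous function $f:X\to B_X$ with $\pi_X(f(x))=x$, i.e. $f(x)\in B_x$, for all $x\in X$. $\Gamma_X$ denotes the Banach space, with norm $\|f\|=\sup_{x\in X}\|f(x)\|$, of all continuous sections vanishing at infinity, i.e. with $\lim_{x\to\infty}\|f(x)\|=0$. $\Gamma_Y$ is defined in the same way from $\langle B_Y,\pi_Y\rangle$, whose fibers are $B_y=\pi_Y^{-1}(y)$, $y\in Y$. Strictly convex: a Banach space $E$ is strictly convex if $\|x+y\|<2$ whenever $x\neq y$ in $E$ with $\|x\|=\|y\|=1$. A Banach bundle is strictly convex if every one of its fiber Banach spaces is strictly convex. The subset $Y_1\subseteq Y$ carries the subspace topology.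
   Formalization: The formal theorem additionally assumes that X is nonempty and that every fiber of the Banach bundle over X is nonzero; both are forced by the conclusion (a nonempty Y_1 mapped onto X, norm one operators on every fiber), which fails without them. *)

(* Defs.v *)
From HB Require Import structures.
From mathcomp Require Import all_boot all_order all_algebra.
From mathcomp Require Import all_classical all_reals all_analysis.
From mathcomp Require Import complex.

Set Implicit Arguments.
Unset Strict Implicit.
Unset Printing Implicit Defensive.

Import Order.TTheory GRing.Theory Num.Theory.
Import numFieldNormedType.Exports.

Local Open Scope classical_set_scope.
Local Open Scope ring_scope.

Variant scalar_kind := RealScalars | ComplexScalars.

Definition scalars (R : realType) (k : scalar_kind) : numFieldType :=
  match k with RealScalars => R : numFieldType | ComplexScalars => R[i] : numFieldType end.

(* In MathComp the norm of a normed module over [K] takes its values in [K];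
   its values are nonnegative reals, which [realval] brings back to [R]. *)
Definition realval (R : realType) (k : scalar_kind) : scalars R k -> R :=
  match k with RealScalars => id | ComplexScalars => @complex.Re R end.

Definition rnorm (R : realType) (k : scalar_kind)
  (V : normedModType (scalars R k)) (v : V) : R := realval `|v|.

(* The fiber [bproj @^-1` [set x]] is presented as a Banach space [fiber x]
   together with mutually inverse bijections [emb x] and [coord x] between
   [fiber x] and that preimage; the values of [coord x] outside of the preimage
   are irrelevant.  Surjectivity of [bproj] follows from [bproj_emb].
   In [zero_limit], filters on the total space play the role of nets. *)
Record banach_bundle (K : numFieldType) (X : topologicalType) := BanachBundle {
  total : topologicalType;
  bproj : total -> X;
  fiber : X -> completeNormedModType K;
  emb : forall x, fiber x -> total;
  coord : forall x, total -> fiber x;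
  bproj_emb : forall x (v : fiber x), bproj (emb v) = x;
  embK : forall x (v : fiber x), coord x (emb v) = v;
  coordK : forall x b, bproj b = x -> emb (coord x b) = b;
  fiber_topology : forall x (U : set (fiber x)),
    open U <-> exists2 V : set total, open V & @emb x @^-1` V = U;
  bproj_continuous : continuous bproj;
  bproj_open : forall U : set total, open U -> open (bproj @` U);
  bscale_continuous : continuous (fun p : K * total =>
    emb (p.1 *: coord (bproj p.2) p.2));
  badd_continuous :
    {within [set p : total * total | bproj p.1 = bproj p.2],
      continuous (fun p : total * total =>
        emb (coord (bproj p.1) p.1 + coord (bproj p.1) p.2))};
  bnorm_continuous : continuous (fun b : total => `|coord (bproj b) b| : K);
  zero_limit : forall (x : X) (F : set_system total), ProperFilter F ->
    (fun b : total => `|coord (bproj b) b| : K) @ F --> (0 : K) ->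
    bproj @ F --> x -> F --> emb (0 : fiber x)
}.
Arguments emb {K X} _ {x} v.
Arguments coord {K X} _ x b.

Definition strictly_convex (K : numFieldType) (E : normedModType K) :=
  forall x y : E, `|x| = 1 -> `|y| = 1 -> x != y -> `|x + y| < 2.

Definition strictly_convex_bundle (K : numFieldType) (X : topologicalType)
    (B : banach_bundle K X) :=
  forall x, strictly_convex (fiber B x).

(* A section is given by its values [f x] in the fibers; as a map into the
   total space it is [fun x => emb B (f x)]. *)
Record section0 (K : numFieldType) (X : topologicalType)
    (B : banach_bundle K X) := Section0 {
  section_val :> forall x, fiber B x;
  section_continuous : continuous (fun x => emb B (section_val x));
  section_vanish : forall e : K, 0 < e -> exists2 C : set X,
    compact C & forall x, ~ C x -> `|section_val x| < e
}.

Section SectionModule.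
Context (K : numFieldType) (X : topologicalType) (B : banach_bundle K X).
Local Notation G := (section0 B).

Lemma section0_ext (f g : G) : (forall x, f x = g x) -> f = g.
Proof.
case: f g => [f cf vf] [g cg vg] /= fg.
have E : f = g by apply: functional_extensionality_dep.
by subst g; congr Section0; apply: Prop_irrelevance.
Qed.

Lemma zero_section_continuous : continuous (fun x => emb B (0 : fiber B x)).
Proof.
move=> x; apply: (@zero_limit K X B x).
- rewrite -fmap_comp (_ : _ \o _ = fun=> (0 : K)); first exact: cvg_cst.
  by apply/funext => y /=; rewrite bproj_emb embK normr0.
- rewrite -fmap_comp (_ : _ \o _ = id); first exact: cvg_id.
  by apply/funext => y /=; rewrite bproj_emb.
Qed.

Lemma add_section_continuous (f g : G) :
  continuous (fun x => emb B (f x + g x)).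
Proof.
move=> x.
pose P := [set p : total B * total B | bproj p.1 = bproj p.2].
pose s y : total B * total B := (emb B (f y), emb B (g y)).
have Ps y : P (s y) by rewrite /P /s /= !bproj_emb.
have cs : s @ nbhs x --> within P (nbhs (s x)).
  move=> U wU.
  have cs : s @ nbhs x --> nbhs (s x).
    by apply: cvg_pair; apply: section_continuous.
  have := cs _ wU; rewrite /nbhs /=.
  by apply: filterS => y /= h; apply: h (Ps y).
have /subspace_continuousP /(_ (s x) (Ps x)) badd := @badd_continuous K X B.
have := cvg_comp _ _ cs badd.
rewrite /from_subspace /comp /s /= bproj_emb !embK.
under eq_fun do rewrite bproj_emb !embK.
exact.
Qed.

Lemma scale_section_continuous (a : K) (f : G) :
  continuous (fun x => emb B (a *: f x)).
Proof.
move=> x.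
pose s y : K * total B := (a, emb B (f y)).
have cs : s @ nbhs x --> nbhs (s x).
  have c1 : (fun=> a) @ nbhs x --> a by exact: cvg_cst.
  by refine (cvg_pair c1 _); exact: section_continuous.
have := cvg_comp _ _ cs (@bscale_continuous K X B (s x)).
rewrite /comp /s /= bproj_emb !embK.
under eq_fun do rewrite bproj_emb !embK.
exact.
Qed.

Lemma zero_section_vanish (e : K) : 0 < e ->
  exists2 C : set X, compact C & forall x, ~ C x -> `|0 : fiber B x| < e.
Proof. by exists set0 => [|x _]; [exact: compact0 | rewrite normr0]. Qed.

Lemma add_section_vanish (f g : G) (e : K) : 0 < e ->
  exists2 C : set X, compact C & forall x, ~ C x -> `|f x + g x| < e.
Proof.
move=> e0; have e2 : 0 < e / 2 by rewrite divr_gt0.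
have [C cC fC] := section_vanish f e2; have [D cD gD] := section_vanish g e2.
exists (C `|` D) => [|x /not_orP[nC nD]]; first exact: compactU.
by rewrite (le_lt_trans (ler_normD _ _))// (splitr e) ltrD ?fC ?gD.
Qed.

Lemma scale_section_vanish (a : K) (f : G) (e : K) : 0 < e ->
  exists2 C : set X, compact C & forall x, ~ C x -> `|a *: f x| < e.
Proof.
move=> e0; have a0 : 0 < `|a| + 1 by rewrite ltr_wpDl.
have [C cC fC] := section_vanish f (divr_gt0 e0 a0).
exists C => // x /fC; rewrite ltr_pdivlMr// => lte.
rewrite normrZ mulrC (le_lt_trans _ lte)//.
by rewrite ler_wpM2l// lerDl.
Qed.

Definition zero_section : G :=
  Section0 zero_section_continuous zero_section_vanish.
Definition add_section (f g : G) : G :=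
  Section0 (@add_section_continuous f g) (@add_section_vanish f g).
Definition scale_section (a : K) (f : G) : G :=
  Section0 (@scale_section_continuous a f) (@scale_section_vanish a f).
Definition opp_section (f : G) : G := scale_section (-1) f.

HB.instance Definition _ := gen_eqMixin G.
HB.instance Definition _ := gen_choiceMixin G.

Lemma add_sectionA : associative add_section.
Proof. by move=> f g h; apply: section0_ext => x /=; rewrite addrA. Qed.

Lemma add_sectionC : commutative add_section.
Proof. by move=> f g; apply: section0_ext => x /=; rewrite addrC. Qed.

Lemma add_section0 : left_id zero_section add_section.
Proof. by move=> f; apply: section0_ext => x /=; rewrite add0r. Qed.

Lemma add_sectionN : left_inverse zero_section opp_section add_section.
Proof. by move=> f; apply: section0_ext => x /=; rewrite scaleN1r addNr. Qed.

HB.instance Definition _ := GRing.isZmodule.Build G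
  add_sectionA add_sectionC add_section0 add_sectionN.

Lemma scale_sectionA a b (f : G) :
  scale_section a (scale_section b f) = scale_section (a * b) f.
Proof. by apply: section0_ext => x /=; rewrite scalerA. Qed.

Lemma scale_section1 : left_id 1 scale_section.
Proof. by move=> f; apply: section0_ext => x /=; rewrite scale1r. Qed.

Lemma scale_sectionDr : right_distributive scale_section +%R.
Proof. by move=> a f g; apply: section0_ext => x /=; rewrite scalerDr. Qed.

Lemma scale_sectionDl (f : G) :
  {morph scale_section^~ f : a b / a + b >-> a + b}.
Proof. by move=> a b; apply: section0_ext => x /=; rewrite scalerDl. Qed.

HB.instance Definition _ := GRing.Zmodule_isLmodule.Build K G
  scale_sectionA scale_section1 scale_sectionDr scale_sectionDl.

End SectionModule.

Definition section_norm_on (R : realType) (k : scalar_kind) (X : topologicalType)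
    (B : banach_bundle (scalars R k) X) (A : set X) (f : section0 B) : R :=
  sup [set rnorm (f x) | x in A].

Definition section_norm (R : realType) (k : scalar_kind) (X : topologicalType)
    (B : banach_bundle (scalars R k) X) (f : section0 B) : R :=
  section_norm_on [set: X] f.

(* Continuity is required separately because [sup] of an unbounded set is 0. *)
Definition operator_norm (R : realType) (k : scalar_kind)
    (E F : normedModType (scalars R k)) (h : E -> F) : R :=
  sup [set rnorm (h v) | v in [set v : E | rnorm v <= 1]].

Definition norm_one_operator (R : realType) (k : scalar_kind)
    (E F : normedModType (scalars R k)) (h : {linear E -> F}) : Prop :=
  continuous h /\ operator_norm h = 1.

(* Main.v *)
Require Import Defs.
From HB Require Import structures.
From mathcomp Require Import all_boot all_order all_algebra.
From mathcomp Require Import all_classical all_reals all_analysis.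
From mathcomp Require Import finmap complex lra.
Import Defs.

(** The proof has two independent ingredients.

    Existence of sections.  Every vector [v] of a fiber over [x] is the value
    at [x] of a global section vanishing at infinity ([section_extension]); this
    is the theorem of Douady and dal Soglio-Herault for locally compact bases.
    A family [s] of vectors is continuous up to an error [e] at [x] when every
    neighborhood of [s x] in the total space contains, for [z] near [x], a
    vector over [z] at distance at most [e z] from [s z] ([approx_cont]).
    Errors add up under sums and are multiplied by [`|l|] under multiplication
    by a continuous function [l], so that a partition of unity glues families
    of error [d] into a family of error [d].  Locally the error of a family can
    be made as small as desired without moving it by more than its current
    error, by choosing vectors in a neighborhood where vectors of the same fiber
    are close to each other; such a neighborhood meets all nearby fibers since
    the projection is open.  Gluing on a compact neighborhood of [x] and halving
    the error repeatedly gives a uniformly Cauchy sequence, whose limit is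
    continuous.  The bump functions centered elsewhere are taken to vanish at
    [x], which keeps the value at [x] equal to [v] throughout.

    The isometry.  For a unit vector [v] over [x], let [peak v] be the set of
    the sections of norm at most one with value [v] at [x], and [norming v] the
    set of the points [y] where [T f] has norm one for every [f] in [peak v].
    As [peak v] is convex, the sets where the single [T f] have norm one are
    directed downwards; they are nonempty, closed and contained in a compact
    set, hence [norming v] is nonempty ([norming_nonempty]).  At a point [y] of
    [norming v], strict convexity of the fiber forces all [T f y] with [f] in
    [peak v] to coincide.  If [f x = 0] and [f] has norm at most one, then for
    every [g0] in [peak v] both [g = (1 - `|f|) g0] and [f + g] lie in [peak v],
    so that [T f y = 0] ([norming_vanish]).  Hence [T f y] depends on [f x]
    only, through an operator which has norm one because sections extend vectors
    without increasing the norm.  The points [x] for different [y] are told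
    apart, and the map [y |-> x] is seen to be continuous, by means of elements
    of [peak v] supported near [x] ([peak_supported]). *)

Import Order.TTheory GRing.Theory Num.Theory.
Import numFieldNormedType.Exports.

Local Open Scope classical_set_scope.
Local Open Scope ring_scope.

Set Implicit Arguments.
Unset Strict Implicit.
Unset Printing Implicit Defensive.

(** * Real scalars and real-valued norms *)

Definition ofreal (R : realType) (k : scalar_kind) : R -> scalars R k :=
  match k with
  | RealScalars => id
  | ComplexScalars => fun r => complex.Complex r 0
  end.
Arguments ofreal {R} k r.

Section Scalars.
Context (R : realType) (k : scalar_kind).
Local Notation K := (scalars R k).

Lemma ofrealK : cancel (ofreal k) (@realval R k).
Proof. by case: k. Qed.

Lemma ofrealD a b : ofreal k (a + b) = ofreal k a + ofreal k b :> K.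
Proof. by case: k => //; exact: (raddfD (real_complex R)). Qed.

Lemma ofrealM a b : ofreal k (a * b) = ofreal k a * ofreal k b :> K.
Proof. by case: k => //; exact: (rmorphM (real_complex R)). Qed.

Lemma ofreal0 : ofreal k 0 = 0 :> K. Proof. by case: k. Qed.
Lemma ofreal1 : ofreal k 1 = 1 :> K. Proof. by case: k. Qed.

Lemma ofrealN a : ofreal k (- a) = - ofreal k a :> K.
Proof. by case: k => //; exact: (raddfN (real_complex R)). Qed.

Lemma ler_ofreal a b : (ofreal k a <= ofreal k b :> K) = (a <= b).
Proof. by case: k => //; exact: lecR. Qed.

Lemma ltr_ofreal a b : (ofreal k a < ofreal k b :> K) = (a < b).
Proof. by case: k => //; exact: ltcR. Qed.

Lemma ge0_ofreal (a : K) : 0 <= a -> a = ofreal k (realval a).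
Proof.
case: k a => //= a a0; rewrite -[LHS](@RRe_real R)//; exact: ger0_real.
Qed.

Lemma normr_ofreal a : `|ofreal k a : K| = ofreal k `|a|.
Proof.
have [a0|a0] := leP 0 a; rewrite [RHS]/=.
  by rewrite (ger0_norm a0) ger0_norm// -ofreal0 ler_ofreal.
by rewrite (ltr0_norm a0) ofrealN ltr0_norm// -ofreal0 ltr_ofreal.
Qed.

Lemma realvalB (a b : K) : realval (a - b) = realval a - realval b.
Proof. by case: k a b => // -[a a'] [b b']. Qed.

Lemma normr_realval (a : K) : `|realval a| <= realval `|a|.
Proof.
case: k a => //= -[x y] /=.
by rewrite -sqrtr_sqr ler_wsqrtr// lerDl sqr_ge0.
Qed.

Lemma realval_continuous : continuous (@realval R k).
Proof.
move=> a; apply/(@cvgrPdist_lt _ R^o _ (nbhs a)) => e e0.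
have e1 : 0 < ofreal k e by rewrite -ofreal0 ltr_ofreal.
apply/nbhs_ballP; exists (ofreal k e) => //= b; rewrite -ball_normE /=.
rewrite -realvalB (@ge0_ofreal `|a - b|)// ltr_ofreal.
exact/le_lt_trans/normr_realval.
Qed.

Lemma ofreal_continuous : continuous (ofreal k : R -> K).
Proof.
move=> a; apply/(@cvgrPdist_lt _ K^o _ (nbhs a)) => e e0.
have e1 : 0 < realval e by rewrite -ltr_ofreal -ge0_ofreal ?ltW// ofreal0.
apply/nbhs_ballP; exists (realval e) => //= b; rewrite -ball_normE /=.
rewrite -ofrealN -ofrealD normr_ofreal.
by rewrite -ltr_ofreal -ge0_ofreal ?ltW.
Qed.

Section Norm.
Context (V : normedModType K).
Implicit Types u v : V.

Lemma ofreal_rnorm v : ofreal k (rnorm v) = `|v|.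
Proof. by rewrite /rnorm -ge0_ofreal. Qed.

Lemma rnorm_ge0 v : 0 <= rnorm v.
Proof. by rewrite -ler_ofreal ofreal_rnorm ofreal0. Qed.

Lemma rnorm0 : rnorm (0 : V) = 0.
Proof. by rewrite /rnorm normr0 -ofreal0 ofrealK. Qed.

Lemma rnorm_eq0 v : (rnorm v == 0) = (v == 0).
Proof.
apply/eqP/eqP => [v0|->]; last exact: rnorm0.
by apply/eqP; rewrite -normr_eq0 -ofreal_rnorm v0 ofreal0.
Qed.

Lemma ler_rnormD u v : rnorm (u + v) <= rnorm u + rnorm v.
Proof. by rewrite -ler_ofreal ofrealD !ofreal_rnorm ler_normD. Qed.

Lemma rnormN v : rnorm (- v) = rnorm v.
Proof. by rewrite /rnorm normrN. Qed.

Lemma rnormZ (a : K) v : rnorm (a *: v) = realval `|a| * rnorm v.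
Proof.
apply: (can_inj ofrealK); rewrite ofrealM !ofreal_rnorm normrZ.
by rewrite -ge0_ofreal.
Qed.

Lemma rnormZr (a : R) v : rnorm (ofreal k a *: v) = `|a| * rnorm v.
Proof. by rewrite rnormZ normr_ofreal ofrealK. Qed.

Lemma rnorm_normalize v : v != 0 -> rnorm (ofreal k (rnorm v)^-1 *: v) = 1.
Proof.
move=> v0; have nv : 0 < rnorm v.
  by rewrite lt_neqAle rnorm_ge0 eq_sym rnorm_eq0 v0.
by rewrite rnormZr gtr0_norm ?invr_gt0// mulVf// gt_eqF.
Qed.

Lemma rnorm_sum (I : Type) (r : seq I) (F : I -> V) :
  rnorm (\sum_(i <- r) F i) <= \sum_(i <- r) rnorm (F i).
Proof.
elim/big_rec2: _ => [|i a v _ av]; first by rewrite rnorm0.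
by rewrite (le_trans (ler_rnormD _ _))// lerD2l.
Qed.

End Norm.
End Scalars.

Arguments ler_ofreal {R} k a b.
Arguments ltr_ofreal {R} k a b.

(** * Neighborhoods in the total space *)

Section BundleNeighborhoods.
Context (R : realType) (k : scalar_kind) (X : topologicalType).
Local Notation K := (scalars R k).
Context (B : banach_bundle K X).
Implicit Types (x z : X) (N : set (total B)).

(** This is where the openness of the projection is used. *)
Lemma near_lift x (v : fiber B x) N : nbhs (emb B v) N ->
  \forall z \near x, exists c : fiber B z, N (emb B c).
Proof.
rewrite nbhsE => -[U [oU Uv] UN].
have /open_nbhs_nbhs : open_nbhs x (@bproj _ _ B @` U).
  by split; [exact: bproj_open | exists (emb B v) => //; exact: bproj_emb].
apply: filterS => z [b Ub bz].
by exists (coord B z b); rewrite coordK//; exact: UN.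
Qed.

Lemma add_nbhs x (u v : fiber B x) N : nbhs (emb B (u + v)) N ->
  exists N1 N2, [/\ nbhs (emb B u) N1, nbhs (emb B v) N2 &
    forall z (a b : fiber B z), N1 (emb B a) -> N2 (emb B b) ->
      N (emb B (a + b))].
Proof.
move=> Nuv; have Puv : [set p : total B * total B | bproj p.1 = bproj p.2]
    (emb B u, emb B v) by rewrite /= !bproj_emb.
have /subspace_continuousP /(_ _ Puv) := @badd_continuous K X B.
rewrite /from_subspace /= bproj_emb !embK => /(_ _ Nuv).
case=> -[N1 N2] [/= N1u N2v] N12; exists N1, N2; split=> // z a b Na Nb.
by have := N12 (emb B a, emb B b); rewrite /= !bproj_emb !embK; exact.
Qed.

Lemma scale_nbhs x (t : K) (u : fiber B x) N : nbhs (emb B (t *: u)) N ->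
  exists A N1, [/\ nbhs t A, nbhs (emb B u) N1 &
    forall z a (c : fiber B z), A a -> N1 (emb B c) -> N (emb B (a *: c))].
Proof.
move=> Ntu; have := @bscale_continuous K X B (t, emb B u).
rewrite /continuous_at /= bproj_emb embK => /(_ _ Ntu).
case=> -[A N1] [/= At N1u] AN1; exists A, N1; split=> // z a c Aa Nc.
by have := AN1 (a, emb B c); rewrite /= bproj_emb embK; exact.
Qed.

Lemma total_rnorm_continuous :
  continuous (fun b : total B => rnorm (coord B (bproj b) b)).
Proof.
move=> b; have := @bnorm_continuous K X B b.
by move=> /(cvg_comp _ _)/(_ (@realval_continuous R k _)).
Qed.

Lemma norm_nbhs x (u : fiber B x) (r : R) : rnorm u < r ->
  nbhs (emb B u) [set b : total B | rnorm (coord B (bproj b) b) < r].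
Proof.
move=> ur; have := @total_rnorm_continuous (emb B u).
rewrite /continuous_at /= bproj_emb embK => h.
exact: (@cvgr_lt R _ (nbhs (emb B u)) _ _ _ h _ ur).
Qed.

(** Tubes of small vectors over neighborhoods of [x] form a basis of
    neighborhoods of [0] in the fiber over [x]: they are a filter basis whose
    filter satisfies the hypotheses of the axiom [zero_limit]. *)
Lemma zero_nbhs x N : nbhs (emb B (0 : fiber B x)) N ->
  exists2 e : R, 0 < e &
    \forall z \near x, forall d : fiber B z, rnorm d < e -> N (emb B d).
Proof.
pose F : set_system (total B) := [set M : set (total B) | exists2 e : R, 0 < e &
    \forall z \near x, forall d : fiber B z, rnorm d < e -> M (emb B d)].
have FF : ProperFilter F.
  apply: Build_ProperFilter_ex => [M [e e0 /nbhs_singleton]|].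
    move=> /(_ 0); rewrite rnorm0 => /(_ e0) M0.
    by exists (emb B (0 : fiber B x)).
  split.
  - by exists 1 => //; near=> z.
  - move=> M M' [e e0 Me] [e' e'0 Me']; exists (Num.min e e').
      by rewrite lt_min e0.
    near=> z => d; rewrite lt_min => /andP[de de'].
    split; [exact: (near Me z)|exact: (near Me' z)].
  - move=> M M' MM' [e e0 Me]; exists e => //.
    by apply: filterS Me => z Me d /Me /MM'.
have := @zero_limit K X B x F FF.
have F_norm : (fun b : total B => `|coord B (bproj b) b| : K) @ F --> (0 : K).
  apply/(@cvgrPdist_lt _ K^o) => e e0.
  exists (realval e).
    by rewrite -(ltr_ofreal k) -ge0_ofreal ?ltW// ofreal0.
  near=> z => d; rewrite /= bproj_emb embK sub0r normrN normr_id.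
  by rewrite -(ltr_ofreal k) ofreal_rnorm -ge0_ofreal ?ltW.
have F_proj : @bproj _ _ B @ F --> x.
  move=> U xU; exists 1 => //; apply: filterS xU => z Uz d _.
  by rewrite /= bproj_emb.
by move=> /(_ F_norm F_proj) Fx /Fx.
Unshelve. all: by end_near. Qed.


(** Continuity of [(a, b) |-> `|a - b|] at [(v, v)]. *)
Lemma thin_nbhs x (v : fiber B x) (e : R) : 0 < e ->
  exists W : set (total B), [/\ open W, W (emb B v) &
    forall z (a b : fiber B z), W (emb B a) -> W (emb B b) ->
      rnorm (a - b) < e].
Proof.
move=> e0; have : rnorm (v + (-1) *: v) < e by rewrite scaleN1r subrr rnorm0.
move=> /norm_nbhs /add_nbhs [N1 [N2 [N1v N2v N12]]].
have [A [N3 [A1 N3v AN3]]] := scale_nbhs N2v.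
have : nbhs (emb B v) (N1 `&` N3) by exact: filterI.
rewrite nbhsE => -[W [oW Wv] WN].
exists W; split=> // z a b /WN[aN1 _] /WN[_ bN3].
have := N12 _ _ _ aN1 (AN3 _ _ _ (nbhs_singleton A1) bN3).
by rewrite /= bproj_emb embK scaleN1r.
Qed.

Lemma section_rnorm_continuous (f : section0 B) :
  continuous (fun x => rnorm (f x)).
Proof.
have -> : (fun x => rnorm (f x)) =
    (fun b : total B => rnorm (coord B (bproj b) b)) \o (fun x => emb B (f x)).
  by apply/funext => x /=; rewrite bproj_emb embK.
move=> x; apply: continuous_comp; first exact: section_continuous.
exact: total_rnorm_continuous.
Qed.

End BundleNeighborhoods.

(** * Families continuous up to an error *)

Section ApproximateContinuity.
Context (R : realType) (k : scalar_kind) (X : topologicalType).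
Local Notation K := (scalars R k).
Context (B : banach_bundle K X).
Local Notation family := (forall z, fiber B z).
Implicit Types (x z : X) (N : set (total B)) (s t : family) (e : X -> R).

(** The error [e] is a function of the base point, and not a constant, so that
    the errors of the terms of a convex combination add up exactly. *)
Definition approx_cont s e x := forall N, nbhs (emb B (s x)) N ->
  \forall z \near x,
    exists2 c : fiber B z, N (emb B c) & rnorm (c - s z) <= e z.

Lemma approx_le s e e' x : (\forall z \near x, e z <= e' z) ->
  approx_cont s e x -> approx_cont s e' x.
Proof.
move=> ee' se N /se sN; near=> z.
have [c Nc cs] : exists2 c : fiber B z, N (emb B c) & rnorm (c - s z) <= e z.
  by near: z.
by exists c => //; apply: le_trans cs _; near: z.
Unshelve. all: by end_near. Qed.

Lemma approx_near_eq s t e x : (\forall z \near x, s z = t z) ->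
  approx_cont s e x -> approx_cont t e x.
Proof.
move=> st se N; rewrite -(nbhs_singleton st) => /se sN; near=> z.
by rewrite -(near st z)//; near: z.
Unshelve. all: by end_near. Qed.

Lemma approx0 x : approx_cont (fun=> 0) (fun=> 0) x.
Proof.
move=> N /zero_nbhs [e e0 eN]; near=> z; exists 0.
  by apply: (near eN z) => //; rewrite rnorm0.
by rewrite subr0 rnorm0.
Unshelve. all: by end_near. Qed.

Lemma approxD s t e e' x : approx_cont s e x -> approx_cont t e' x ->
  approx_cont (fun z => s z + t z) (fun z => e z + e' z) x.
Proof.
move=> se te N /add_nbhs [N1 [N2 [/se N1s /te N2t N12]]]; near=> z.
have [c Nc cs] : exists2 c : fiber B z, N1 (emb B c) & rnorm (c - s z) <= e z.
  by near: z.
have [d Nd dt] : exists2 c : fiber B z, N2 (emb B c) & rnorm (c - t z) <= e' z.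
  by near: z.
exists (c + d); first exact: N12.
by rewrite opprD addrACA (le_trans (ler_rnormD _ _))// lerD.
Unshelve. all: by end_near. Qed.

Lemma approxZ (l : X -> R) s e x : {for x, continuous l} -> approx_cont s e x ->
  approx_cont (fun z => ofreal k (l z) *: s z) (fun z => `|l z| * e z) x.
Proof.
move=> lx se N /scale_nbhs [A [N1 [Al /se N1s AN]]].
have lA : \forall z \near x, A (ofreal k (l z)).
  exact: (cvg_comp _ _ lx (@ofreal_continuous R k (l x))).
near=> z.
have [c Nc cs] : exists2 c : fiber B z, N1 (emb B c) & rnorm (c - s z) <= e z.
  by near: z.
exists (ofreal k (l z) *: c); first by apply: AN => //; near: z.
by rewrite -scalerBr rnormZr ler_wpM2l.
Unshelve. all: by end_near. Qed.

Lemma approx_sum (I : Type) (r : seq I) (F : I -> family) (e : I -> X -> R) x :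
  (forall i, approx_cont (F i) (e i) x) ->
  approx_cont (fun z => \sum_(i <- r) F i z) (fun z => \sum_(i <- r) e i z) x.
Proof.
move=> Fe; elim: r => [|i r IH].
  apply: (approx_near_eq (s := fun=> 0)); first by near=> z; rewrite big_nil.
  by apply: approx_le (@approx0 x); near=> z; rewrite big_nil.
apply: (approx_near_eq (s := fun z => F i z + \sum_(i <- r) F i z)).
  by near=> z; rewrite big_cons.
by apply: approx_le (approxD (Fe i) IH); near=> z; rewrite big_cons.
Unshelve. all: by end_near. Qed.

(** Some vector of norm less than [m + d] near [s x] exists over each nearby
    point, and any two vectors of norms [m + d] and [m] are close enough. *)
Lemma approx_bounded s (m d : R) x : 0 < d ->
  (\forall z \near x, rnorm (s z) <= m) -> approx_cont s (fun=> 2 * m + d) x.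
Proof.
move=> d0 sm N Ns.
have sd : rnorm (s x) < m + d.
  by rewrite (le_lt_trans (nbhs_singleton sm))// ltrDl.
have Nd : nbhs (emb B (s x))
    (N `&` [set b : total B | rnorm (coord B (bproj b) b) < m + d]).
  by apply: filterI => //; exact: norm_nbhs.
have := near_lift Nd => Nd'; near=> z.
have [c [Nc]] : exists c : fiber B z,
    (N `&` [set b : total B | rnorm (coord B (bproj b) b) < m + d]) (emb B c).
  by near: z.
rewrite /= bproj_emb embK => cm; exists c => //.
rewrite (le_trans (ler_rnormD _ _))// rnormN.
have : rnorm (s z) <= m by near: z.
lra.
Unshelve. all: by end_near. Qed.

(** A vector [s z] that is close to a vector [c] near [s x] is [c] plus a small
    vector; both addition at [(s x, 0)] and the basis of neighborhoods of zero
    then put it in a given neighborhood of [s x]. *)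
Lemma approx_continuous s x : (forall d : R, 0 < d -> approx_cont s (fun=> d) x) ->
  {for x, continuous (fun z => emb B (s z))}.
Proof.
move=> sa N; rewrite /= -[s x]addr0 => /add_nbhs [N1 [N2 [N1s N2z N12]]].
have [d d0 dN] := zero_nbhs N2z.
have d2 : 0 < d / 2 by rewrite divr_gt0.
have sd := sa _ d2 _ N1s.
suff : \forall z \near x, N (emb B (s z)) by [].
near=> z.
have [c Nc cs] : exists2 c : fiber B z, N1 (emb B c) & rnorm (c - s z) <= d / 2.
  by near: z.
rewrite -[s z](subrKC c); apply: N12 => //; apply: (near dN z) => //.
by rewrite -rnormN opprB (le_lt_trans cs)// ltr_pdivrMr// ltr_pMr// ltr1n.
Unshelve. all: by end_near. Qed.

(** The family [r] takes its values in a neighborhood of [s x] where vectors of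
    the same fiber are at distance less than [d].  Near each of its points, this
    neighborhood contains vectors over all nearby points, and these are
    automatically [d]-close to [r]. *)
Lemma approx_refine_near s (E d : R) x : 0 < d -> 0 <= E ->
  approx_cont s (fun=> E) x -> exists (r : family) (U : set X),
  [/\ open U, U x, r x = s x & forall z, U z ->
      approx_cont r (fun=> d) z /\ rnorm (r z - s z) <= E].
Proof.
move=> d0 E0 sE; have [W [oW Ws Wd]] := thin_nbhs (s x) d0.
pose P z := [set c : fiber B z |
  [/\ W (emb B c), rnorm (c - s z) <= E & z = x -> c = s z]].
have : nbhs x [set z | P z !=set0].
  have := sE _ (open_nbhs_nbhs (conj oW Ws)); apply: filterS => z [c Wc cE].
  have [->|zx] := EM (z = x); last by exists c.
  by exists (s x); split=> //; rewrite subrr rnorm0.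
rewrite nbhsE => -[U [oU Ux] UP].
pose r z := xget 0 (P z).
have rP z : U z -> P z (r z) by move=> /UP /xgetPex; exact.
exists r, U; split=> // [|z Uz]; first by have [_ _ ->] := rP _ Ux.
have [Wr rE _] := rP z Uz; split=> // N Nr.
have NW : nbhs (emb B (r z)) (N `&` W).
  by apply: filterI => //; exact: open_nbhs_nbhs.
have := near_lift NW => NWl; have nU : nbhs z U by exact: open_nbhs_nbhs.
near=> y; have [c [Nc Wc]] : exists c : fiber B y, (N `&` W) (emb B c).
  by near: y.
have Uy : U y by near: y.
by exists c => //; have [Wry _ _] := rP _ Uy; exact/ltW/Wd.
Unshelve. all: by end_near. Qed.

End ApproximateContinuity.

(** * Refinement over a compact set *)

(** Outside of [U] the function vanishes on a neighborhood of each point: [U]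
    together with the interior of the zero set covers [X], which is what
    multiplication of a family defined on [U] by [psi] requires. *)
Lemma bump_function (R : realType) (X : topologicalType) (x : X) (U : set X) :
  hausdorff_space X -> locally_compact [set: X] -> open U -> U x ->
  exists psi : X -> R, [/\ continuous psi, (forall z, 0 <= psi z <= 1),
    psi x = 1 & forall z, U z \/ \forall w \near z, psi w = 0].
Proof.
move=> hX lX oU Ux.
have /(@uniform_separatorP _ R) [f [cf f01 f0 f1]] :=
  @locally_compact_completely_regular X R lX hX x (~` U) (open_closedC oU)
    (fun nUx => nUx Ux).
(* Truncation at the level 1/2 of the Urysohn function [f] makes [psi] vanish
   near, and not only at, the points where [f] is 1. *)
exists (fun z => Num.max (1 - 2 * f z) 0); split.
- move=> z; apply: (@continuous_max R X (fun z => 1 - 2 * f z) (fun=> 0)).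
    apply: cvgB; first exact: cvg_cst.
    by apply: cvgM; [exact: cvg_cst|exact: cf].
  exact: cvg_cst.
- move=> z; have /f01 : range f (f z) by exists z.
  rewrite /= in_itv/= le_max ge_max lexx orbT => /andP[? ?].
  by apply/andP; split=> //; apply/andP; split; lra.
- by rewrite (f0 (f x)); [rewrite mulr0 subr0; apply/max_idPl; lra|exists x].
- move=> z; have [Uz|nUz] := EM (U z); [by left|right].
  have fz : f z = 1 by apply: f1; exists z.
  have : 1 / 2 < f z by rewrite fz; lra.
  move=> /(@cvgr_gt R _ (nbhs z) _ f _ (cf z)).
  by apply: filterS => w fw; apply/max_idPr; lra.
Qed.

Section CompactRefinement.
Context (R : realType) (k : scalar_kind) (X : topologicalType).
Local Notation K := (scalars R k).
Context (B : banach_bundle K X).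
Hypotheses (X_hausdorff : hausdorff_space X) (X_lc : locally_compact [set: X]).
Local Notation family := (forall z, fiber B z).
Implicit Types (x z : X) (s t : family).

(** Gluing of the local refinements [approx_refine_near] with a partition of
    unity.  At [x0] only refinements agreeing with [s] contribute, because the
    bump functions centered at other points are supported away from [x0]. *)
Lemma approx_refine_compact (C : set X) (x0 : X) s (E d : R) :
  compact C -> C x0 -> 0 < d -> 0 <= E ->
  (forall z, C z -> approx_cont s (fun=> E) z) ->
  exists r : family, [/\ r x0 = s x0,
    (forall z, C z -> approx_cont r (fun=> d) z) &
    forall z, C z -> rnorm (r z - s z) <= E].
Proof.
move=> cC Cx0 d0 E0 sE.
have local x : exists p : (X -> R) * family,
    [/\ continuous p.1, (forall z, 0 <= p.1 z), C x -> 0 < p.1 x,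
      p.1 x0 = 0 \/ p.2 x0 = s x0 &
      forall z, (\forall w \near z, p.1 w = 0) \/
        approx_cont p.2 (fun=> d) z /\ rnorm (p.2 z - s z) <= E].
  have [Cx|nCx] := EM (C x); last first.
    exists (fun=> 0, s); split=> //=; [by move=> ?; exact: cvg_cst|by right|].
    by move=> z; left; near=> w.
  have [r [U [oU Ux rx rU]]] := approx_refine_near d0 E0 (sE _ Cx).
  pose V := U `&` [set z | x0 != x -> z != x0].
  have oV : open V.
    apply: openI => //; have [->|x0x] := eqVneq x0 x.
      by rewrite (_ : mkset _ = setT); [exact: openT|apply/seteqP; split].
    rewrite (_ : mkset _ = ~` [set x0]).
      apply: closed_openC; apply: accessible_closed_set1.
      exact: hausdorff_accessible.
    by apply/seteqP; split=> z /= => [/(_ isT)/eqP|/eqP].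
  have Vx : V x by split=> //= x0x; rewrite eq_sym.
  have [psi [cpsi psi01 psix psiV]] := bump_function R X_hausdorff X_lc oV Vx.
  exists (psi, r); split => //=.
  - by move=> z; have /andP[] := psi01 z.
  - by rewrite psix.
  - have [->|x0x] := eqVneq x0 x; first by right.
    left; have [[_ /=]|/nbhs_singleton//] := psiV x0.
    by move=> /(_ x0x); rewrite eqxx.
  - by move=> z; have [[/rU]|] := psiV z; [right|left].
have [p pP] := choice local.
have [D DC CD] : finite_subset_cover C (fun x => [set z | 0 < (p x).1 z]) C.
  (* [compact_cover] is about pointed spaces; [x0] serves as a base point. *)
  pose XP : ptopologicalType := HB.pack X (isPointed.Build X x0).
  have : @cover_compact XP C by rewrite -compact_cover.
  apply => [x _|x Cx].
    rewrite (_ : mkset _ = (p x).1 @^-1` [set y | 0 < y]) //.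
    by apply: open_comp; [move=> z _; have [] := pP x|exact: open_gt].
  by exists x => //; have [_ _ /(_ Cx)] := pP x.
pose S z := \sum_(i <- D) (p i).1 z.
have cS : continuous S.
  by apply: continuous_big => [|i _]; [exact: add_continuous|have [] := pP i].
have S0 z : C z -> 0 < S z.
  move=> /CD [i /= Di piz]; rewrite /S (big_fsetD1 i)//= ltr_pwDl// sumr_ge0//.
  by move=> j _; have [_ ->] := pP j.
pose w i z := (p i).1 z / S z.
have w0 i z : C z -> 0 <= w i z.
  by move=> /S0 Sz; have [_ p0 _ _ _] := pP i; rewrite divr_ge0// ltW.
have w1 z : C z -> \sum_(i <- D) w i z = 1.
  by move=> /S0 Sz; rewrite -mulr_suml divff// gt_eqF.
pose r z := \sum_(i <- D) ofreal k (w i z) *: (p i).2 z.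
have rB z : C z ->
    r z - s z = \sum_(i <- D) ofreal k (w i z) *: ((p i).2 z - s z).
  move=> Cz; under [RHS]eq_bigr do rewrite scalerBr.
  rewrite sumrB -scaler_suml; congr (_ - _).
  rewrite (_ : \sum_(i <- D) ofreal k (w i z) = ofreal k (\sum_(i <- D) w i z)).
    by rewrite w1// ofreal1 scale1r.
  by elim/big_rec2: _ => [|i a b _ ->]; rewrite ?ofreal0 ?ofrealD.
exists r; split => [|z Cz|z Cz].
- apply/eqP; rewrite -subr_eq0 rB// big1// => i _.
  have [_ _ _ [p0|->] _] := pP i; last by rewrite subrr scaler0.
  by rewrite /w p0 mul0r ofreal0 scale0r.
- have Sz := S0 _ Cz.
  apply: (approx_le (e := fun z => \sum_(i <- D) `|w i z| * d)).
    near=> y; rewrite -mulr_suml ler_piMl ?(ltW d0)//.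
    have Sy : 0 < S y.
      by near: y; exact: (@cvgr_gt R _ (nbhs z) _ S _ (cS z)).
    rewrite (eq_bigr (fun i => w i y)) => [|i _].
      by rewrite -mulr_suml divff// gt_eqF.
    by have [_ p0 _ _ _] := pP i; rewrite ger0_norm// divr_ge0// ltW.
  apply: approx_sum => i; have [cp _ _ _ /(_ z)[pz|[pz _]]] := pP i.
    apply: (approx_near_eq (s := fun=> 0)).
      near=> y; rewrite /w (_ : (p i).1 y = 0) ?mul0r ?ofreal0 ?scale0r//.
      by near: y.
    apply: approx_le (@approx0 _ _ _ B z).
    by near=> y; rewrite mulr_ge0// ltW.
  apply: approxZ => //; apply: cvgM; first exact: cp.
  by apply: cvgV; [rewrite gt_eqF|exact: cS].
- rewrite rB// (le_trans (rnorm_sum _ _))//.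
  rewrite (le_trans (y := \sum_(i <- D) w i z * E))//.
    apply: ler_sum => i _; rewrite rnormZr ger0_norm ?w0//.
    have [_ _ _ _ /(_ z)[/nbhs_singleton pz|[_ pz]]] := pP i.
      by rewrite /w pz !mul0r.
    by rewrite ler_wpM2l// w0.
  by rewrite -mulr_suml w1// mul1r.
Unshelve. all: by end_near. Qed.

End CompactRefinement.

(** * Extension of vectors to sections *)

Lemma geometric_small (R : realType) (c e : R) :
  0 < e -> \forall n \near \oo, c / 2 ^+ n < e.
Proof.
move=> e0; near=> n; rewrite ltr_pdivrMr ?exprn_gt0//.
have : c / e < n%:R by near: n; exact: nbhs_infty_gtr.
rewrite ltr_pdivrMr// => /lt_trans; apply; rewrite mulrC ltr_pM2l//.
by rewrite -natrX ltr_nat ltn_expl.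
Unshelve. all: by end_near. Qed.

Lemma geometric_limit (R : realType) (k : scalar_kind)
    (V : completeNormedModType (scalars R k)) (u : nat -> V) (E : R) :
  (forall n, rnorm (u n.+1 - u n) <= E / 2 ^+ n) ->
  exists l, forall n, rnorm (l - u n) <= 2 * E / 2 ^+ n.
Proof.
move=> uE.
have p2 n : 0 < 2 ^+ n :> R by rewrite exprn_gt0.
have E0 : 0 <= E by have := uE 0; rewrite expr0 divr1; apply/le_trans/rnorm_ge0.
have tail n m :
    rnorm (u (n + m)%N - u n) <= 2 * E / 2 ^+ n - 2 * E / 2 ^+ (n + m).
  elim: m => [|m IH]; first by rewrite addn0 !subrr rnorm0.
  rewrite -(subrKA (u (n + m)%N)) (le_trans (ler_rnormD _ _))// addnS.
  have := uE (n + m)%N; move: IH; rewrite exprS invfM; lra.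
have {}tail n m : (n <= m)%N -> rnorm (u m - u n) <= 2 * E / 2 ^+ n.
  move=> nm; have := tail n (m - n)%N; rewrite subnKC// => /le_trans; apply.
  by rewrite gerBl divr_ge0// ?mulr_ge0// ltW.
have cu : cauchy (u @ \oo).
  apply/cauchy_ballP => e e0.
  have e1 : 0 < realval e by rewrite -(ltr_ofreal k) -ge0_ofreal ?ltW// ofreal0.
  have e2 : 0 < realval e / 2 by rewrite divr_gt0.
  have [N _ NE] := geometric_small (2 * E) e2.
  have uN n : (N <= n)%N -> rnorm (u n - u N) < realval e / 2.
    by move=> Nn; apply: le_lt_trans (tail _ _ Nn) _; apply: NE => /=.
  pose A := [set u n | n in [set n | (N <= n)%N]]; exists (A, A).
    by split; exists N => // n /= Nn; exists n.
  move=> [_ _] [/= [n Nn <-] [m Nm <-]]; rewrite -ball_normE /=.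
  rewrite -ofreal_rnorm (ge0_ofreal (ltW e0)) ltr_ofreal.
  rewrite -(subrKA (u N)) (le_lt_trans (ler_rnormD _ _))//.
  by rewrite [ltRHS]splitr ltrD ?uN// -rnormN opprB uN.
have /cauchy_cvgP/cvg_ex[l ul] := cu.
exists l => n; apply/ler_addgt0Pr => d d0.
have d1 : 0 < ofreal k d by rewrite -ofreal0 ltr_ofreal.
have := @cvgr_dist_lt _ _ _ _ _ _ _ ul _ d1 => ld.
near \oo => m.
rewrite -(subrKA (u m)) (le_trans (ler_rnormD _ _))// addrC lerD//.
  by apply: tail; near: m; exact: nbhs_infty_ge.
by rewrite -(ler_ofreal k) ofreal_rnorm; apply/ltW; near: m; exact: ld.
Unshelve. all: by end_near. Qed.

Section SectionExtension.
Context (R : realType) (k : scalar_kind) (X : topologicalType).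
Local Notation K := (scalars R k).
Context (B : banach_bundle K X).
Hypotheses (X_hausdorff : hausdorff_space X) (X_lc : locally_compact [set: X]).
Local Notation family := (forall z, fiber B z).

(** Iterated refinement, starting from the discontinuous family that is [v] at
    [x0] and [0] elsewhere: being bounded, it is continuous up to an error.  The
    [n]-th refinement has error [E / 2 ^ n] and is moved by no more than that by
    the next one, so that the refinements converge uniformly on [C]. *)
Lemma compact_section (C : set X) (x0 : X) (v : fiber B x0) :
  compact C -> C x0 -> exists s : family, s x0 = v /\
    forall z, C° z -> forall d : R, 0 < d -> approx_cont s (fun=> d) z.
Proof.
move=> cC Cx0; pose E := 2 * rnorm v + 1.
have E0 : 0 < E by rewrite /E; have := rnorm_ge0 v; lra.
have En n : 0 < E / 2 ^+ n by rewrite divr_gt0// exprn_gt0.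
pose good n (s : family) := s x0 = v /\
  forall z, C z -> approx_cont s (fun=> E / 2 ^+ n) z.
have step (q : nat * family) : exists r : family, good q.1 q.2 ->
    good q.1.+1 r /\ forall z, C z -> rnorm (r z - q.2 z) <= E / 2 ^+ q.1.
  case: q => n s /=; have [[sx sa]|] := EM (good n s); last by exists s.
  have [r [rx ra rs]] := approx_refine_compact X_hausdorff X_lc cC Cx0
    (En n.+1) (ltW (En n)) sa.
  by exists r => _; split=> //; split=> //; rewrite rx.
have [next nextP] := choice step.
pose start : family := fun z => if z == x0 then coord B z (emb B v) else 0.
pose u := fix u n := if n is m.+1 then next (m, u m) else start.
have uP n : good n (u n).
  elim: n => [|n /(nextP (n, _))[]//]; split => [|z _] /=.
    by rewrite /start eqxx embK.
  rewrite expr0 divr1; apply: approx_bounded => //; near=> y.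
  rewrite /start; case: eqP => [->|_]; first by rewrite embK.
  by rewrite rnorm0 rnorm_ge0.
have uE z : C z -> forall n, rnorm (u n.+1 z - u n z) <= E / 2 ^+ n.
  by move=> Cz n; have [_ ->] := nextP (n, _) (uP n).
have lim z : exists l, C z -> forall n, rnorm (l - u n z) <= 2 * E / 2 ^+ n.
  have [Cz|nCz] := EM (C z); last by exists 0.
  by have [l lP] := geometric_limit (uE z Cz); exists l.
pose s z := projT1 (cid (lim z)).
have sP z : C z -> forall n, rnorm (s z - u n z) <= 2 * E / 2 ^+ n.
  by rewrite /s; case: cid.
exists s; split.
  apply/eqP; rewrite -subr_eq0 -rnorm_eq0 eq_le rnorm_ge0 andbT.
  apply/ler_addgt0Pr => d d0; rewrite add0r.
  near \oo => n; have [<- _] := uP n.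
  apply: le_trans (sP _ Cx0 n) _; apply: ltW; near: n.
  exact: geometric_small.
move=> z Cz d d0; have d2 : 0 < d / 2 by rewrite divr_gt0.
near \oo => n.
(* The error is E / 2 ^ n for [u n], and twice the bound 2 * E / 2 ^ n, up to
   d / 2, for the difference [s - u n]. *)
have nd : 5 * E / 2 ^+ n < d / 2 by near: n; exact: geometric_small.
have [_ /(_ z (interior_subset Cz)) un] := uP n.
have su : approx_cont (fun y => s y - u n y)
    (fun=> 2 * (2 * E / 2 ^+ n) + d / 2) z.
  by apply: approx_bounded => //; apply: filterS Cz => y /sP; exact.
apply: (approx_near_eq (s := fun y => u n y + (s y - u n y))).
  by near=> y; rewrite subrKC.
apply: approx_le (approxD un su); near=> y; lra.
Unshelve. all: by end_near. Qed.

(** The theorem of Douady and dal Soglio-Herault: a section obtained near [x0]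
    from [compact_section] is cut off by a bump function. *)
Theorem section_extension (x0 : X) (v : fiber B x0) :
  exists f : section0 B, f x0 = v.
Proof.
have [C wC [cC _]] := X_lc (I : [set: X] x0).
have xC : nbhs x0 C.
  have : nbhs x0 [set z | [set: X] z -> C z] := wC.
  by apply: filterS => z; exact.
have [s [sx sa]] := compact_section v cC (nbhs_singleton xC).
have [psi [cpsi psi01 psix psiC]] :=
  bump_function R X_hausdorff X_lc (open_interior C) xC.
pose f z := ofreal k (psi z) *: s z.
have cf : continuous (fun z => emb B (f z)).
  move=> z; apply: approx_continuous => d d0.
  have [Cz|pz] := psiC z.
    apply: approx_le (approxZ (@cpsi z) (sa z Cz d d0)); near=> y.
    by have /andP[? ?] := psi01 y; rewrite ger0_norm// ler_piMl// ltW.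
  apply: (approx_near_eq (s := fun=> 0)).
    by near=> y; rewrite /f (_ : psi y = 0) ?ofreal0 ?scale0r//; near: y.
  by apply: approx_le (@approx0 _ _ _ B z); near=> y; exact: ltW.
have vf (e : K) : 0 < e ->
    exists2 C : set X, compact C & forall z, ~ C z -> `|f z| < e.
  move=> e0; exists C => // z nCz.
  have [/interior_subset//|/nbhs_singleton p0] := psiC z.
  by rewrite /f p0 ofreal0 scale0r normr0.
by exists (Section0 cf vf); rewrite /= /f psix ofreal1 scale1r.
Unshelve. all: by end_near. Qed.

End SectionExtension.

(** * The space of sections *)

Lemma sup_attained (R : realType) (A : set R) (m : R) :
  A m -> ubound A m -> sup A = m.
Proof.
move=> Am mA; apply/eqP; rewrite eq_le ge_sup//=; last by exists m.
by apply: ub_le_sup => //; exists m.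
Qed.

Section SectionNorm.
Context (R : realType) (k : scalar_kind) (X : topologicalType).
Local Notation K := (scalars R k).
Context (B : banach_bundle K X).
Implicit Types (x z : X) (f : section0 B).

Lemma section_rnorm_max x f : exists z, forall y, rnorm (f y) <= rnorm (f z).
Proof.
have [[x1 fx1]|/forallNP f0] := EM (exists x1, f x1 != 0); last first.
  exists x => y; have /negP := f0 y; rewrite negbK => /eqP ->.
  by rewrite rnorm0 rnorm_ge0.
have e0 : 0 < `|f x1| by rewrite normr_gt0.
have [C cC fC] := section_vanish f e0.
have Cx1 : C x1 by apply: contrapT => /fC; rewrite ltxx.
have C0 : C !=set0 by exists x1.
have cf : {within C, continuous (fun y => rnorm (f y))}.
  by apply: continuous_subspaceT; exact: section_rnorm_continuous.
have [z _ zm] := compact_EVT_max C0 cC cf.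
exists z => y; have [Cy|/fC nCy] := EM (C y); first exact/zm/mem_set.
apply: le_trans (zm x1 _); last exact: mem_set.
by rewrite -(ler_ofreal k) !ofreal_rnorm ltW.
Qed.

Lemma section_norm_max z f : (forall y, rnorm (f y) <= rnorm (f z)) ->
  section_norm f = rnorm (f z).
Proof.
move=> fz; apply: sup_attained; first by exists z.
by move=> _ [y _ <-]; exact: fz.
Qed.

Lemma rnorm_le_section_norm f x : rnorm (f x) <= section_norm f.
Proof. by have [z fz] := section_rnorm_max x f; rewrite (section_norm_max fz). Qed.

Lemma section_norm_ge0 f : 0 <= section_norm f.
Proof.
have [[x _]|/nonemptyPn X0] := EM ([set: X] !=set0).
  exact: le_trans (rnorm_ge0 _) (rnorm_le_section_norm f x).
by rewrite /section_norm /section_norm_on X0 image_set0 sup0.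
Qed.

Lemma section_norm_le f (M : R) : 0 <= M -> (forall x, rnorm (f x) <= M) ->
  section_norm f <= M.
Proof.
move=> M0 fM; have [[x _]|/nonemptyPn X0] := EM ([set: X] !=set0).
  by have [z fz] := section_rnorm_max x f; rewrite (section_norm_max fz).
by rewrite /section_norm /section_norm_on X0 image_set0 sup0.
Qed.

Lemma mul_section (l : X -> R) f : continuous l -> (forall x, `|l x| <= 1) ->
  exists g : section0 B, forall x, g x = ofreal k (l x) *: f x.
Proof.
move=> cl l1; pose g x := ofreal k (l x) *: f x.
have cg : continuous (fun x => emb B (g x)).
  move=> x N /scale_nbhs [A [N1 [Al Nf AN]]].
  have lA : \forall z \near x, A (ofreal k (l z)).
    exact: (cvg_comp _ _ (cl x) (@ofreal_continuous R k (l x))).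
  have fN : \forall z \near x, N1 (emb B (f z)).
    exact: (@section_continuous _ _ _ f x).
  suff : \forall z \near x, N (emb B (g z)) by [].
  by near=> z; apply: AN; near: z.
have vg (e : K) : 0 < e ->
    exists2 C : set X, compact C & forall z, ~ C z -> `|g z| < e.
  move=> e0; have [C cC fC] := section_vanish f e0; exists C => // z /fC.
  apply: le_lt_trans.
  by rewrite -!ofreal_rnorm ler_ofreal rnormZr ler_piMl// rnorm_ge0.
by exists (Section0 cg vg).
Unshelve. all: by end_near. Qed.

Hypotheses (X_hausdorff : hausdorff_space X) (X_lc : locally_compact [set: X]).

(** A section [f] extending [v] is multiplied by
    [`|v| / max `|v| `|f|], which is 1 at [x]. *)
Lemma section_extension_norm x (v : fiber B x) :
  exists f : section0 B, f x = v /\ forall z, rnorm (f z) <= rnorm v.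
Proof.
have [->|v0] := eqVneq v 0.
  by exists 0; split=> // z; rewrite !rnorm0.
have nv : 0 < rnorm v by rewrite lt_neqAle rnorm_ge0 eq_sym rnorm_eq0 v0.
have [f fx] := section_extension X_hausdorff X_lc v.
pose m z := Num.max (rnorm v) (rnorm (f z)).
have m0 z : 0 < m z by rewrite lt_max nv.
have cl : continuous (fun z => rnorm v / m z).
  move=> z; apply: cvgM; first exact: cvg_cst.
  apply: cvgV; first by rewrite gt_eqF.
  apply: (@continuous_max R X (fun=> rnorm v) (fun z => rnorm (f z))).
    exact: cvg_cst.
  exact: section_rnorm_continuous.
have l0 z : 0 <= rnorm v / m z by rewrite divr_ge0// ltW.
have l1 z : `|rnorm v / m z| <= 1.
  by rewrite ger0_norm// ler_pdivrMr// mul1r le_max lexx.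
have [g gf] := mul_section f cl l1; exists g; split.
  by rewrite gf /m fx maxxx divff ?gt_eqF// ofreal1 scale1r.
move=> z; rewrite gf rnormZr ger0_norm// mulrAC ler_pdivrMr//.
rewrite ler_wpM2l ?rnorm_ge0//.
by rewrite /m le_max lexx orbT.
Qed.

End SectionNorm.

(** * Linear isometries into strictly convex bundles *)

Lemma linear_contraction_continuous (R : realType) (k : scalar_kind)
    (V W : normedModType (scalars R k)) (h : {linear V -> W}) :
  (forall u, rnorm (h u) <= rnorm u) -> continuous h.
Proof.
move=> hC u; apply/cvgrPdist_lt => e e0; apply/nbhs_ballP; exists e => //= w.
rewrite -ball_normE /= -linearB; apply: le_lt_trans.
by rewrite -!ofreal_rnorm ler_ofreal.
Qed.

Section Isometry.
Context (R : realType) (k : scalar_kind) (X Y : topologicalType).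
Local Notation K := (scalars R k).
Context (X_hausdorff : hausdorff_space X) (X_lc : locally_compact [set: X]).
Context (BX : banach_bundle K X) (BY : banach_bundle K Y).
Context (BY_convex : strictly_convex_bundle BY).
Context (T : {linear section0 BX -> section0 BY}).
Hypothesis T_isometry :
  forall f : section0 BX, section_norm (T f) = section_norm f.
Implicit Types (x : X) (y : Y) (f g : section0 BX).

Definition peak x (v : fiber BX x) : set (section0 BX) :=
  [set f | f x = v /\ forall z, rnorm (f z) <= 1].

Definition norming x (v : fiber BX x) : set Y :=
  [set y | forall f, peak v f -> rnorm (T f y) = 1].

Lemma rnorm_T_le f y (M : R) : 0 <= M -> (forall z, rnorm (f z) <= M) ->
  rnorm (T f y) <= M.
Proof.
move=> M0 fM; apply: le_trans (rnorm_le_section_norm (T f) y) _.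
by rewrite T_isometry; exact: section_norm_le.
Qed.

Lemma rnorm_T_peak x (v : fiber BX x) f y : peak v f -> rnorm (T f y) <= 1.
Proof. by move=> [_ f1]; exact: rnorm_T_le. Qed.

Lemma peak_nonempty x (v : fiber BX x) : rnorm v = 1 -> exists f, peak v f.
Proof.
move=> v1; have [f [fx]] := section_extension_norm X_hausdorff X_lc v.
by rewrite v1; exists f.
Qed.

Lemma peak_midpoint x (v : fiber BX x) f g : peak v f -> peak v g ->
  peak v (ofreal k (1 / 2) *: (f + g)).
Proof.
move=> [fx f1] [gx g1]; split => [|z] /=.
  rewrite fx gx -{1 2}[v]scale1r -scalerDl scalerA -ofreal1 -ofrealD -ofrealM.
  by rewrite (_ : 1 / 2 * (1 + 1) = 1) ?ofreal1 ?scale1r//; lra.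
rewrite rnormZr ger0_norm; last lra.
have := ler_rnormD (f z) (g z); have := f1 z; have := g1 z; lra.
Qed.

Lemma T_midpoint f g y :
  T (ofreal k (1 / 2) *: (f + g)) y = ofreal k (1 / 2) *: (T f y + T g y).
Proof. by rewrite linearZ linearD. Qed.

Lemma peak_supported x (v : fiber BX x) (U : set X) : rnorm v = 1 ->
  open U -> U x -> exists2 g, peak v g & forall z, U z \/ g z = 0.
Proof.
move=> v1 oU Ux.
have [psi [cpsi psi01 psix psiU]] := bump_function R X_hausdorff X_lc oU Ux.
have psi1 z : `|psi z| <= 1 by have /andP[? ?] := psi01 z; rewrite ger0_norm.
have [f [fx f1]] := peak_nonempty v1.
have [g gE] := mul_section f cpsi psi1; exists g.
  split=> [|z]; first by rewrite gE psix ofreal1 scale1r.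
  by rewrite gE rnormZr (le_trans _ (f1 z))// ler_piMl// rnorm_ge0.
move=> z; have [|/nbhs_singleton p0] := psiU z; first by left.
by right; rewrite gE p0 ofreal0 scale0r.
Qed.

(** A cluster point of the filter generated by the sets where [T f] has norm at
    least one, for [f] in [peak v].  The midpoint of two elements of [peak v]
    shows that these sets form a filter basis; each contains a maximum point of
    [T f] since [T] is isometric, and they are closed and contained in compact
    sets since the [T f] vanish at infinity. *)
Lemma norming_nonempty x (v : fiber BX x) : rnorm v = 1 -> norming v !=set0.
Proof.
move=> v1; have [f0 f0v] := peak_nonempty v1.
pose L f := [set y | 1 <= rnorm (T f y)].
have L0 f : peak v f -> L f !=set0.
  move=> [fx f1].
  have T1 : section_norm (T f) = 1.
    by rewrite T_isometry (@section_norm_max _ _ _ _ x) fx ?v1.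
  have [[y _]|/nonemptyPn Y0] := EM ([set: Y] !=set0).
    have [z zm] := section_rnorm_max y (T f); exists z.
    by rewrite /L /= -(section_norm_max zm) T1.
  move: T1; rewrite /section_norm /section_norm_on Y0 image_set0 sup0 => /esym/eqP.
  by rewrite oner_eq0.
have FL : ProperFilter (filter_from (peak v) L).
  apply: filter_from_proper => //; apply: filter_from_filter; first by exists f0.
  move=> f g fv gv; exists (ofreal k (1 / 2) *: (f + g)); first exact: peak_midpoint.
  move=> y; rewrite /L /= T_midpoint rnormZr ger0_norm; last lra.
  have := ler_rnormD (T f y) (T g y).
  have := rnorm_T_peak y fv; have := rnorm_T_peak y gv.
  by move=> ? ? ? ?; split; lra.
have [C cC f0C] := section_vanish (T f0) (ltr01 : 0 < 1 :> K).
have FC : filter_from (peak v) L C.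
  exists f0 => // y; rewrite /L /= => f0y; apply: contrapT => /f0C.
  by rewrite -ofreal_rnorm -ofreal1 ltr_ofreal ltNge f0y.
have [y [_ yL]] := cC _ FL FC.
exists y => f fv; apply/eqP; rewrite eq_le (rnorm_T_peak _ fv) /=.
have clL : closed (L f).
  rewrite (_ : L f = (fun y => rnorm (T f y)) @^-1` [set r | 1 <= r])//.
  by apply: closed_comp => [z _|]; [exact: section_rnorm_continuous|exact: closed_ge].
by apply: clL => U yU; apply: yL => //; exists f.
Qed.

(** [T f y] and [T g y] are unit vectors, and so is their midpoint, which is the
    value at [y] of the image of the midpoint of [f] and [g]. *)
Lemma norming_eq x (v : fiber BX x) f g y : norming v y ->
  peak v f -> peak v g -> T f y = T g y.
Proof.
move=> yv fv gv; apply: contrapT => /eqP fg.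
have norm1 f' : peak v f' -> `|T f' y| = 1 :> K.
  by move=> /yv; rewrite -ofreal_rnorm => ->; rewrite ofreal1.
have := BY_convex (norm1 _ fv) (norm1 _ gv) fg.
rewrite -ofreal_rnorm (_ : 2 = ofreal k 2 :> K); last first.
  by rewrite -[2 in RHS]/(1 + 1) ofrealD ofreal1.
rewrite ltr_ofreal.
have := yv _ (peak_midpoint fv gv); rewrite T_midpoint rnormZr ger0_norm; lra.
Qed.

(** After scaling of [f] to [f'] of norm at most one, the sections
    [g = (1 - `|f'|) g0] and [f' + g] both belong to [peak v], and [T] takes the
    same value on them at [y]. *)
Lemma norming_vanish x (v : fiber BX x) f y : rnorm v = 1 -> norming v y ->
  f x = 0 -> T f y = 0.
Proof.
move=> v1 yv fx; have [g0 [g0x g01]] := peak_nonempty v1.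
pose c := 1 / (section_norm f + 1).
have c0 : 0 < c by rewrite divr_gt0// ltr_wpDl// section_norm_ge0.
pose f' := ofreal k c *: f.
have f'E z : f' z = ofreal k c *: f z by [].
have f'1 z : rnorm (f' z) <= 1.
  rewrite f'E rnormZr gtr0_norm// /c mul1r mulrC.
  rewrite ler_pdivrMr ?ltr_wpDl ?section_norm_ge0//.
  by rewrite mul1r (le_trans (rnorm_le_section_norm _ _))// lerDl.
have cl : continuous (fun z => 1 - rnorm (f' z)).
  by move=> z; apply: cvgB; [exact: cvg_cst|exact: section_rnorm_continuous].
have l1 z : `|1 - rnorm (f' z)| <= 1.
  by have := f'1 z; have := rnorm_ge0 (f' z) => ? ?; rewrite ger0_norm; lra.
have [g gE] := mul_section g0 cl l1.
have f'x : f' x = 0 by rewrite f'E fx scaler0.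
have gx : g x = v by rewrite gE f'x rnorm0 subr0 ofreal1 scale1r.
have gB z : rnorm (g z) <= 1 - rnorm (f' z).
  by rewrite gE rnormZr ger0_norm ?subr_ge0// ler_piMr// subr_ge0.
have gv : peak v g.
  split=> // z; apply: le_trans (gB z) _; have := rnorm_ge0 (f' z); lra.
have fgv : peak v (f' + g).
  split=> [|z] /=; first by rewrite -[LHS]/(f' x + g x) f'x add0r.
  rewrite -[X in rnorm X]/(f' z + g z).
  apply: le_trans (ler_rnormD _ _) _; have := gB z; lra.
have := norming_eq yv fgv gv; rewrite linearD /= => /eqP.
rewrite -subr_eq0 addrK linearZ /= scaler_eq0 => /orP[|/eqP//].
rewrite -(ofreal0 R k) => /eqP/(can_inj (@ofrealK R k)) c00.
by rewrite c00 ltxx in c0.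
Qed.

(** Otherwise some [g] in [peak v] vanishes at [x'], so that [T g y] would be
    both a unit vector and zero. *)
Lemma norming_base_unique x x' (v : fiber BX x) (v' : fiber BX x') y :
  rnorm v = 1 -> rnorm v' = 1 -> norming v y -> norming v' y -> x = x'.
Proof.
move=> v1 v'1 yv yv'; apply: contrapT => xx'.
have oU : open (~` [set x']).
  by apply/closed_openC/accessible_closed_set1/hausdorff_accessible.
have [g gv gU] := peak_supported v1 oU xx'.
have gx' : g x' = 0 by have [/(_ erefl)|] := gU x'.
have := yv _ gv; rewrite (norming_vanish v'1 yv' gx') rnorm0 => /eqP.
by rewrite eq_sym oner_eq0.
Qed.

(** The operator sends [u] to the value at [y] of the image of any section
    extending [u]; [norming_vanish] makes this independent of the extension.
    Its norm is attained at [v]. *)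
Lemma norming_fiber_operator x (v : fiber BX x) y : rnorm v = 1 -> norming v y ->
  exists h : {linear fiber BX x -> fiber BY y},
    norm_one_operator h /\ forall f, T f y = h (f x).
Proof.
move=> v1 yv.
have [ext extP] := choice (@section_extension_norm _ _ _ BX X_hausdorff X_lc x).
pose h0 u := T (ext u) y.
have TE f g : f x = g x -> T f y = T g y.
  move=> fg; apply/eqP; rewrite -subr_eq0; apply/eqP.
  transitivity (T (f - g) y); first by rewrite linearB /= scaleN1r.
  by apply: (norming_vanish v1 yv); rewrite /= scaleN1r fg subrr.
have h0_linear : linear h0.
  move=> a u w; rewrite /h0.
  transitivity (T (a *: ext u + ext w) y); last by rewrite linearP.
  apply: TE; have [-> _] := extP (a *: u + w).
  by rewrite /=; have [-> _] := extP u; have [-> _] := extP w.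
pose h : {linear fiber BX x -> fiber BY y} :=
  HB.pack h0 (GRing.isLinear.Build _ _ _ _ h0 h0_linear).
have hT f : T f y = h (f x) by apply: TE; have [-> _] := extP (f x).
have hC u : rnorm (h u) <= rnorm u.
  by have [fx fu] := extP u; apply: rnorm_T_le => //; exact: rnorm_ge0.
exists h; split=> //; split; first exact: linear_contraction_continuous.
apply: sup_attained.
  exists v; first by rewrite /= v1.
  have [f [fx f1]] := peak_nonempty v1; rewrite -fx -hT.
  by apply: yv; split.
by move=> _ [u /= u1 <-]; exact: le_trans (hC u) u1.
Qed.

End Isometry.

Theorem theorem3p1 (R : realType) (k : scalar_kind) (X Y : topologicalType)
    (X_hausdorff : hausdorff_space X) (X_lc : locally_compact [set: X])
    (Y_hausdorff : hausdorff_space Y) (Y_lc : locally_compact [set: Y])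
    (BX : banach_bundle (scalars R k) X) (BY : banach_bundle (scalars R k) Y)
    (X_nonempty : [set: X] !=set0)
    (BX_nonzero : forall x : X, exists v : fiber BX x, v != 0)
    (BY_convex : strictly_convex_bundle BY)
    (T : {linear section0 BX -> section0 BY})
    (T_isometry : forall f : section0 BX, section_norm (T f) = section_norm f) :
  exists (Y1 : set Y) (phi : Y -> X)
         (h : forall y : Y, {linear fiber BX (phi y) -> fiber BY y}),
    [/\ Y1 !=set0,
        {within Y1, continuous phi},
        phi @` Y1 = [set: X],
        forall y : Y, Y1 y -> norm_one_operator (h y)
      & forall f : section0 BX,
          (forall y : Y, Y1 y -> T f y = h y (f (phi y))) /\
          section_norm_on Y1 (T f) = section_norm (T f)].
Proof.
have [x0 _] := X_nonempty.
pose norms_at (y : Y) (x : X) :=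
  exists v : fiber BX x, rnorm v = 1 /\ norming T v y.
pose Y1 := [set y | exists x, norms_at y x].
have /choice[phi phiP] : forall y, exists x, Y1 y -> norms_at y x.
  move=> y; have [[x yx]|nY] := EM (Y1 y); [by exists x | by exists x0 => /nY].
have phi_unique y x : norms_at y x -> phi y = x.
  move=> yx; have [v [v1 yv]] := phiP y (ex_intro _ x yx).
  have [v' [v'1 yv']] := yx.
  exact: (norming_base_unique X_hausdorff X_lc BY_convex v1 v'1 yv yv').
have /all_tag[h hP] : forall y, {h : {linear fiber BX (phi y) -> fiber BY y} |
    Y1 y -> norm_one_operator h /\ forall f, T f y = h (f (phi y))}.
  move=> y; apply: cid; have [yY1|nY] := EM (Y1 y); last by exists \0 => /nY.
  have [v [v1 yv]] := phiP y yY1.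
  have [h hP] := norming_fiber_operator X_hausdorff X_lc BY_convex T_isometry v1 yv.
  by exists h.
have Y1_onto (x : X) (v : fiber BX x) : rnorm v = 1 ->
    exists y, [/\ Y1 y, phi y = x & norming T v y].
  move=> v1; have [y yv] := norming_nonempty X_hausdorff X_lc T_isometry v1.
  have yx : norms_at y x by exists v.
  by exists y; split; [exists x | exact: phi_unique |].
have Y1_phi (x : X) : exists2 y, Y1 y & phi y = x.
  have [v /rnorm_normalize/Y1_onto[y [? ? _]]] := BX_nonzero x.
  by exists y.
have [y1 y1Y1 _] := Y1_phi x0.
exists Y1, phi, h; split.
- by exists y1.
- apply/subspace_continuousP => y yY1 U; rewrite /= nbhsE => -[V [oV Vy] VU].
  (* [T g z] is nonzero near [y], whereas it would be zero for [z] in [Y1] with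
     [phi z] outside of the support of [g]. *)
  have [v [v1 yv]] := phiP y yY1.
  have [g gv gV] := peak_supported X_hausdorff X_lc v1 oV Vy.
  have Tg : 0 < rnorm (T g y) by rewrite (yv _ gv).
  have := @section_rnorm_continuous _ _ _ _ (T g) y.
  move=> /(@cvgr_gt R _ (nbhs y) _ _ _)/(_ _ Tg) => near_y.
  suff : \forall z \near y, Y1 z -> U (phi z) by [].
  apply: filterS near_y => z Tgz zY1; apply: VU.
  have [//|gz] := gV (phi z).
  by move: Tgz; have [_ ->] := hP z zY1; rewrite gz linear0 rnorm0 ltxx.
- apply/seteqP; split=> // x _; have [y yY1 yx] := Y1_phi x.
  by exists y.
- by move=> y /(hP y)[].
- move=> f; split=> [y /(hP y)[_ ->]//|].
  have [x fx] := section_rnorm_max x0 f.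
  have Tf : section_norm (T f) = rnorm (f x).
    by rewrite T_isometry (section_norm_max fx).
  apply: sup_attained; last first.
    by move=> _ [y _ <-]; exact: rnorm_le_section_norm.
  have [f0|f0] := eqVneq (f x) 0.
    exists y1 => //; apply/eqP; rewrite eq_le rnorm_le_section_norm/=.
    by rewrite Tf f0 rnorm0 rnorm_ge0.
  have nf : 0 < rnorm (f x) by rewrite lt_neqAle rnorm_ge0 eq_sym rnorm_eq0 f0.
  pose c := (rnorm (f x))^-1.
  have c0 : 0 < c by rewrite invr_gt0.
  have [y [yY1 _ yv]] := Y1_onto x _ (rnorm_normalize f0); exists y => //.
  have : rnorm (T (ofreal k c *: f) y) = 1.
    apply: yv; split=> // z; rewrite /= rnormZr gtr0_norm// mulrC.
    by rewrite ler_pdivrMr// mul1r.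
  rewrite linearZ /= rnormZr gtr0_norm// Tf => /(canRL (mulVKf _)) ->.
    by rewrite mulr1.
  by rewrite gt_eqF.
Qed.
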